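(* There exists an integer $n_0$ such that for every $n\ge n_0$ the following holds: if $G$ is a graph of order $n$ with $\mu(G)>\sqrt{\lfloor n^2/4\rfloor}$, then $G$ contains a cycle of length $t$ for every integer $t$ with $3\le t\leq n/160$.
   Context: Graphs are finite and simple. The order of a graph is its number of vertices. $\mu(G)$ denotes the largest eigenvalue of the adjacency matrix of $G$ (the spectral radius). The length of a cycle is its number of edges. *)

(* Defs.v *)
From mathcomp Require Import all_boot all_order all_algebra.
From mathcomp Require Import classical_sets reals.

Set Implicit Arguments.
Unset Strict Implicit.
Unset Printing Implicit Defensive.

Import Order.TTheory GRing.Theory Num.Theory.
Local Open Scope ring_scope.
Local Open Scope classical_set_scope.

Record sgraph := SGraph {
  vertex :> finType;
  adj : rel vertex;
  adj_sym : symmetric adj;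
  adj_irrefl : irreflexive adj }.

Definition adjacency_mx (R : realType) (G : sgraph) : 'M[R]_#|G| :=
  \matrix_(i, j) (adj (enum_val i) (enum_val j))%:R.

(* A square matrix has finitely many eigenvalues, and a nonempty real symmetric
   one has at least one, so for a graph with a vertex this supremum is the
   largest eigenvalue. By the convention on [sup] it is 0 for the empty graph. *)
Definition spectral_radius (R : realType) (G : sgraph) : R :=
  sup [set a : R | eigenvalue (adjacency_mx R G) a].

(* [ucycle] only asks for distinct, cyclically adjacent vertices, which an edge
   traversed back and forth also satisfies; hence the bound on [t]. *)
Definition has_cycle (G : sgraph) (t : nat) : Prop :=
  (3 <= t)%N /\ exists2 c : seq G, ucycle (@adj G) c & size c = t.

(* Main.v *)
Require Import Defs.
From mathcomp Require Import all_boot all_order all_algebra.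
From mathcomp Require Import classical_sets reals.
From mathcomp Require boolp.
From mathcomp Require Import fintype finset zify.

(** Let [x] be an eigenvector for an eigenvalue [a] with [a ^ 2 > n ^ 2 %/ 4],
    and let [v] be a vertex at which [|x|] is largest. Expanding
    [a ^ 2 * x v] as a sum over walks of length two from [v] and bounding every
    entry by [|x v|] shows that the degrees of the neighbours of [v] have a sum
    of at least [a ^ 2] (lemma [eigenvalue_sqr_le]). This is the only use of the
    spectrum; everything after it is counting, with no asymptotics.

    Put [A] for the neighbourhood of [v] and [B] for its complement, so that
    [v] lies in [B] and is joined to all of [A]. Since
    [#|A| * #|B| <= n ^ 2 %/ 4], the degree sum can exceed [n ^ 2 %/ 4] only if
    the edges inside [A], counted twice, outnumber the pairs missing between
    [A] and [B] (lemma [sum_miss_lt]).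

    If [A] spans many edges, it contains a subgraph of minimum degree above
    [t], hence a path on [t - 1] vertices, and [v] closes this path into a
    cycle of length [t] (lemma [nbhd_dense_cycle]).

    Otherwise fewer than [n * #|A| / 80] pairs are missing, so [A] and [B] have
    comparable sizes and most vertices see most of the other side. One
    can then walk greedily back and forth between [A] and [B] for [t] steps,
    and every such walk that begins and ends in [A] is closed by [v] into an
    even cycle. For an odd cycle one puts between [v] and the first vertex [x]
    of the walk a further vertex [u] of [A] adjacent to [x]; it is enough that
    [x], where the walk starts, has few non-neighbours in [B]. Such an edge
    exists (lemma [good_edge]): if every edge inside [A] had both ends among
    the vertices with many non-neighbours in [B], those few vertices would
    miss at least as many pairs as the edges among them, counted twice. *)

Import Order.TTheory GRing.Theory Num.Theory.
Local Open Scope nat_scope.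

(** * Greedy paths *)

(** A path of fewer than [m] steps occupies at most [m] vertices, so its last
    vertex still has an unused successor in [S]. *)
Lemma greedy_path (T : finType) (r : rel T) (S : {set T}) (m : nat) (x : T) :
  x \in S -> (forall y, y \in S -> m < #|[set z in S | r y z]|) ->
  exists p : seq T,
    [/\ path r x p, uniq (x :: p), {subset x :: p <= S} & size p = m].
Proof.
move=> xS degS.
suff: forall j, j <= m -> exists p : seq T,
    [/\ path r x p, uniq (x :: p), {subset x :: p <= S} & size p = j].
  exact.
elim=> [_|j IHj ltjm].
  by exists [::]; split=> // y; rewrite inE => /eqP->.
have [p [rp up pS szp]] := IHj (ltnW ltjm).
have /subsetPn [z] : ~~ ([set z in S | r (last x p) z] \subset x :: p).
  apply/negP => /subset_leq_card; apply/negP; rewrite -ltnNge.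
  apply: leq_ltn_trans (degS _ (pS _ (mem_last x p))).
  by apply: leq_trans (card_size _) _; rewrite /= szp.
rewrite inE => /andP[zS rz] zp; exists (rcons p z); split.
- by rewrite rcons_path rp.
- by rewrite -rcons_cons rcons_uniq zp up.
- by move=> y; rewrite -rcons_cons mem_rcons inE => /predU1P[->//|/pS].
- by rewrite size_rcons szp.
Qed.

Lemma alternating_path_last {T : finType} {r : rel T} {A : {set T}} {p x} :
  path r x p -> (forall y z, r y z -> (y \in A) != (z \in A)) ->
  (last x p \in A) = (x \in A) (+) odd (size p).
Proof.
move=> rp alt; elim: p x rp => [|y p IHp] x /=; first by rewrite addbF.
by case/andP=> /alt + /IHp ->; case: (x \in A); case: (y \in A); case: odd.
Qed.

(** * Degrees into a set *)

Section Graph.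

Variable G : sgraph.
Implicit Types (A B S : {set G}) (u v w x : G).

Definition nbhd v : {set G} := [set w | adj v w].
Definition deg A u := #|[set w in A | adj u w]|.
Definition miss A u := #|[set w in A | ~~ adj u w]|.

Lemma degE A u : deg A u = \sum_(w in A) adj u w.
Proof.
rewrite /deg -sum1_card (eq_bigl (fun w => (w \in A) && adj u w)); last first.
  by move=> w; rewrite inE.
by rewrite big_mkcondr; apply: eq_bigr => w _; case: adj.
Qed.

Lemma missE A u : miss A u = \sum_(w in A) ~~ adj u w.
Proof.
rewrite /miss -sum1_card (eq_bigl (fun w => (w \in A) && ~~ adj u w)).
  by rewrite big_mkcondr; apply: eq_bigr => w _; case: adj.
by move=> w; rewrite inE.
Qed.

Lemma deg_miss A u : deg A u + miss A u = #|A|.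
Proof.
rewrite degE missE -big_split -sum1_card.
by apply: eq_bigr => w _; case: adj.
Qed.

Lemma card_nbhd A u : #|nbhd u| = deg A u + deg (~: A) u.
Proof.
rewrite /deg -(cardsID A); congr (_ + _); apply: eq_card => w; rewrite !inE.
- by rewrite andbC.
- by case: (w \in A); case: adj.
Qed.

Lemma sum_missC A B : \sum_(u in A) miss B u = \sum_(u in B) miss A u.
Proof.
under eq_bigr do rewrite missE.
rewrite exchange_big; apply: eq_bigr => w _; rewrite missE.
by apply: eq_bigr => u _; rewrite adj_sym.
Qed.

(** Markov's inequality for the number of non-neighbours in [B]. *)
Lemma card_miss_gt A B c k :
  #|[set y in A | k < c * miss B y]| * k <= c * \sum_(y in A) miss B y.
Proof.
rewrite -sum_nat_const big_distrr /= [leqLHS]big_mkcond [leqRHS]big_mkcond.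
apply: leq_sum => y _; rewrite inE.
by case: (y \in A) => //=; case: ifP => // /ltnW.
Qed.

(** * Many edges inside the neighbourhood *)

Lemma sum_deg_setD1 A w : w \in A ->
  \sum_(u in A) deg A u =
    \sum_(u in A :\ w) deg (A :\ w) u + (deg A w).*2.
Proof.
move=> wA; rewrite (big_setD1 w) //= addnC -addnn addnA; congr (_ + _).
have -> : deg A w = \sum_(u in A :\ w) adj u w.
  rewrite degE (big_setD1 w) //= adj_irrefl add0n.
  by apply: eq_bigr => u _; rewrite adj_sym.
rewrite -big_split; apply: eq_bigr => u _.
by rewrite !degE (big_setD1 w) //= addnC.
Qed.

(** Deleting a vertex of degree at most [k] lowers the degree sum by at most
    [2 * k], which preserves the hypothesis; the deletions must stop before
    [A] is exhausted, since the empty set violates it. *)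
Lemma dense_core A k : k.*2 * #|A| < \sum_(u in A) deg A u ->
  exists S, [/\ S != set0, S \subset A & forall u, u \in S -> k < deg S u].
Proof.
move: {2}#|A| (leqnn #|A|) => m; elim: m A => [|m IHm] A leAm dA.
  move: leAm; rewrite leqn0 cards_eq0 => /eqP A0.
  by move: dA; rewrite A0 big_set0 ltn0.
case: (boolP [exists u in A, deg A u <= k]) => [/exists_inP[w wA dw]|].
  have cA : #|A| = (#|A :\ w|).+1 by rewrite (cardsD1 w) wA.
  have [||S [S0 SA dS]] := IHm (A :\ w).
  - by rewrite cA in leAm.
  - move: dA; rewrite (sum_deg_setD1 _ _ wA) cA mulnS addnC => dA.
    rewrite -(ltn_add2r (k.*2)); apply: leq_trans dA _.
    by rewrite leq_add2l leq_double.
  by exists S; split=> //; apply: subset_trans SA (subD1set _ _).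
move=> /exists_inPn dA2; exists A; split=> //.
  by apply: contraTneq dA => ->; rewrite big_set0.
by move=> u /dA2; rewrite -ltnNge.
Qed.

Lemma has_cycle_cons v x (p : seq G) :
  0 < size p -> path (@adj G) x p -> uniq (v :: x :: p) ->
  adj v x -> adj v (last x p) -> has_cycle G (size p).+2.
Proof.
move=> p0 xp uvxp vx vl; split=> //; exists [:: v, x & p] => //.
by rewrite /ucycle uvxp andbT /= vx rcons_path xp adj_sym.
Qed.

(** The core given by [dense_core] contains a path on [t - 1] vertices, all of
    which are adjacent to [v]. *)
Lemma nbhd_dense_cycle v t : 2 < t ->
  t.*2 * #|nbhd v| < \sum_(u in nbhd v) deg (nbhd v) u -> has_cycle G t.
Proof.
move=> t3 /dense_core[S [/set0Pn[x xS] SA dS]].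
have inA y : y \in S -> adj v y by move=> /(subsetP SA); rewrite inE.
have [|p [xp up pS szp]] := greedy_path _ (@adj G) S (t - 2) x xS _.
  by move=> y /dS; apply: leq_ltn_trans; lia.
have -> : t = (size p).+2 by lia.
apply: (has_cycle_cons v x) => //; first by lia.
- rewrite cons_uniq up andbT; apply/negP => /pS/inA.
  by rewrite adj_irrefl.
- exact: inA.
- exact/inA/pS/mem_last.
Qed.

(** * Few edges inside the neighbourhood *)

(** Each [u] in [A] has as many neighbours as [B] has vertices, plus its
    neighbours in [A], minus its non-neighbours in [B]. The claim follows by
    summation, because [#|A| * #|B| <= n ^ 2 / 4]. *)
Lemma sum_miss_lt A : #|G| ^ 2 %/ 4 < \sum_(u in A) #|nbhd u| ->
  \sum_(u in A) miss (~: A) u < \sum_(u in A) deg A u.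
Proof.
move=> lt.
have eq1 : \sum_(u in A) #|nbhd u| + \sum_(u in A) miss (~: A) u =
           \sum_(u in A) deg A u + #|A| * #|~: A|.
  rewrite -big_split /= -sum_nat_const -big_split /=.
  by apply: eq_bigr => u _; rewrite (card_nbhd A) -addnA deg_miss.
have : #|A| * #|~: A| <= #|G| ^ 2 %/ 4.
  by rewrite leq_divRL // -(cardsC A) mulnC; apply: (nat_AGM2 #|A| #|~: A|).
lia.
Qed.

(** Let [bad] be the set of vertices of [A] with more than [n / 10]
    non-neighbours in [B]. By Markov's inequality it has fewer than [n / 10]
    elements. If both ends of every edge in [A] were bad, the degree sum in [A]
    would be at most [#|bad| ^ 2 <= #|bad| * n / 10], which the missing pairs at
    the bad vertices alone already reach. *)
Lemma good_edge A t : 160 * t <= #|G| -> 5 * #|A| <= 3 * #|G| ->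
  \sum_(u in A) miss (~: A) u < \sum_(u in A) deg A u <= t.*2 * #|A| ->
  exists u x, [/\ u \in A, x \in A, adj u x & 10 * miss (~: A) x <= #|G|].
Proof.
move=> tG AG /andP[ltMD leDt].
pose bad := [set x in A | #|G| < 10 * miss (~: A) x].
case: (boolP [exists u in A, exists x in A, adj u x && (x \notin bad)]).
  move=> /exists_inP[u uA /exists_inP[x xA /andP[ux]]].
  by rewrite inE xA -leqNgt /=; exists u, x.
move=> noedge.
have edge_bad u x : u \in A -> x \in A -> adj u x -> x \in bad.
  move=> uA xA ux; apply: contraNT noedge => xbad.
  by apply/exists_inP; exists u => //; apply/exists_inP; exists x; rewrite ?ux.
have bad_miss : #|bad| * #|G| <= 10 * \sum_(u in A) miss (~: A) u :=
  card_miss_gt _ _ _ _.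
have deg_bad : \sum_(u in A) deg A u <= #|bad| * #|bad|.
  rewrite -sum_nat_const big_mkcond [leqRHS]big_mkcond /=; apply: leq_sum => u _.
  case: ifP => // uA; case: ifP => [_|/negP ubad].
    apply/subset_leq_card/subsetP => x; rewrite inE => /andP[xA].
    exact: edge_bad.
  rewrite leqn0 cards_eq0; apply/eqP/setP => x; rewrite !inE.
  apply/negP => /andP[xA]; rewrite adj_sym => xu.
  by apply: ubad; apply: edge_bad xu.
have : 8 * #|bad| < #|A| by nia.
nia.
Qed.

(** The product of the two sizes is close to its maximum [n ^ 2 / 4], so the
    sizes are balanced: each part has at least two fifths of the vertices. *)
Lemma part_sizes A t : 160 * t <= #|G| ->
  #|G| ^ 2 < 4 * (#|A| * #|~: A| + t.*2 * #|A|) ->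
  (2 * #|A| <= 3 * #|~: A|) && (2 * #|~: A| <= 3 * #|A|).
Proof.
move=> tG; have := cardsC A; move: #|A| #|~: A| => a b ab lt.
have {}lt : 20 * #|G| ^ 2 < 80 * (a * b) + #|G| * a by nia.
move: lt; rewrite -ab => lt.
by apply/andP; split; rewrite leqNgt; apply/negP => ltab; nia.
Qed.

(** The path alternates between the vertices of [A] and of [B] that miss few
    vertices of the other side, avoiding [u] and [v]; it starts at the end [x]
    of a good edge and has an even number of steps, so that it ends in [A]. *)
Lemma nbhd_sparse_cycle v t : 2 < t -> 160 * t <= #|G| ->
  let A := nbhd v in
  #|G| ^ 2 < 4 * (#|A| * #|~: A| + t.*2 * #|A|) ->
  \sum_(u in A) miss (~: A) u < \sum_(u in A) deg A u <= t.*2 * #|A| ->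
  has_cycle G t.
Proof.
move=> t3 tG A sizeA sums.
have /andP[szA szB] := part_sizes _ _ tG sizeA.
have szG := cardsC A.
have A5 : 5 * #|A| <= 3 * #|G| by lia.
have [u [x [uA xA ux gx]]] := good_edge _ _ tG A5 sums.
have [ltMD leDt] := andP sums.
pose goodA := [set y in A | 10 * miss (~: A) y <= #|G|].
pose badA := [set y in A | #|G| < 10 * miss (~: A) y].
pose goodB := [set y in ~: A | 2 * miss A y <= #|A|].
pose badB := [set y in ~: A | #|A| < 2 * miss A y].
have card_badA : 8 * #|badA| <= #|A|.
  have : #|badA| * #|G| <= 10 * \sum_(y in A) miss (~: A) y.
    exact: card_miss_gt.
  nia.
have card_badB : 40 * #|badB| <= #|G|.
  have : #|badB| * #|A| <= 2 * \sum_(y in A) miss (~: A) y.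
    rewrite sum_missC; exact: card_miss_gt.
  nia.
pose r y z := adj y z && ((y \in A) != (z \in A)).
pose S := (goodA :|: goodB) :\: [set u; v].
have vA : v \notin A by rewrite inE adj_irrefl.
have uv : u != v by apply: contraNneq vA => <-.
(* Both kinds of vertices of [S] keep more than [t] neighbours across: at least
   [(2/5 - 1/10 - 1/40) * n - 1] from [A] to [B], and from [B] to [A] at least
   [(1/2 - 1/8) * (2/5) * n - 1]. *)
have degS y : y \in S -> t < #|[set z in S | r y z]|.
  set Sr := [set z in S | r y z].
  have cover (W X : {set G}) c : W \subset c |: (X :|: Sr) ->
      #|W| <= (#|X| + #|Sr|).+1.
    move=> /subset_leq_card; rewrite cardsU1 cardsU; lia.
  rewrite !inE negb_or -!andbA => /and3P[_ _ /orP[]/andP[yA gy]].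
    have : deg (~: A) y <= (#|badB| + #|Sr|).+1.
      apply: (cover _ _ v); apply/subsetP => z; rewrite !inE /r !inE.
      move=> /andP[vz yz].
      case: (altP (z =P v)) => //= zv.
      have zu : z != u by apply: contraNneq vz => ->; move: uA; rewrite inE.
      rewrite (negbTE zu) vz (negbTE vz) yz yA /=.
      by case: leqP.
    have := deg_miss (~: A) y; lia.
  have : deg A y <= (#|badA| + #|Sr|).+1.
    apply: (cover _ _ u); apply/subsetP => z; rewrite !inE /r !inE.
    move=> /andP[vz yz].
    case: (altP (z =P u)) => //= zu.
    have zv : z != v by apply: contraTneq vz => ->; rewrite adj_irrefl.
    rewrite (negbTE zv) vz yz (negbTE yA) /=.
    by case: leqP.
  have := deg_miss A y; lia.
have xS : x \in S.
  have xu : x != u by apply: contraTneq ux => ->; rewrite adj_irrefl.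
  have xv : x != v by apply: contraTneq xA => ->.
  by move: xA; rewrite !inE negb_or xu xv gx => ->.
(* The cycle is [v :: x :: p] for even [t], [v :: u :: x :: p] for odd [t]. *)
pose m := if odd t then t - 3 else t - 2.
have [|p [rp up pS szp]] := greedy_path _ r S m x xS _.
  move=> y /degS; apply: leq_ltn_trans.
  by rewrite /m; case: ifP => _; apply: leq_subr.
have lastA : last x p \in A.
  rewrite (alternating_path_last (A := A) rp); last by move=> y z /andP[].
  rewrite xA szp /m; case: ifP => [t_odd|/negbT t_even].
    by rewrite oddB ?t_odd.
  by rewrite oddB ?(negbTE t_even) // ltnW.
have ap : path (@adj G) x p by apply: sub_path rp => y z /andP[].
have vp : v \notin x :: p by apply/negP => /pS; rewrite !inE eqxx orbT.
have up' : u \notin x :: p by apply/negP => /pS; rewrite !inE eqxx.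
have inA y : y \in A -> adj v y by rewrite inE.
case: (boolP (odd t)) => t_odd; rewrite /m ?t_odd ?(negbTE t_odd) in szp.
  have -> : t = (size (x :: p)).+2 by rewrite /= szp -addn3 subnK.
  apply: (has_cycle_cons v u) => //=; last 2 first.
  - exact: inA.
  - exact: inA.
  - by rewrite ux.
  - by rewrite inE negb_or (eq_sym v) uv vp up' -cons_uniq up.
have p0 : 0 < size p
  by rewrite szp; case: t t3 t_odd {tG sizeA sums leDt degS m szp} => [|[|[|]]].
have -> : t = (size p).+2 by rewrite szp -addn2 subnK // ltnW.
by apply: (has_cycle_cons v x) => //; rewrite ?cons_uniq ?vp ?up //; apply: inA.
Qed.

(** The combinatorial form of the theorem: a vertex whose neighbours have a
    degree sum exceeding [n ^ 2 / 4] replaces the spectral hypothesis. *)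
Lemma heavy_vertex_cycle v t :
  #|G| ^ 2 %/ 4 < \sum_(u in nbhd v) #|nbhd u| ->
  2 < t -> 160 * t <= #|G| -> has_cycle G t.
Proof.
move=> heavy t3 tG; have ltMD := sum_miss_lt _ heavy.
have [dense|sparse] :=
  ltnP (t.*2 * #|nbhd v|) (\sum_(u in nbhd v) deg (nbhd v) u).
  exact: (nbhd_dense_cycle v).
apply: (nbhd_sparse_cycle v) => //; last by rewrite ltMD.
have : \sum_(u in nbhd v) #|nbhd u| <=
       #|nbhd v| * #|~: nbhd v| + \sum_(u in nbhd v) deg (nbhd v) u.
  rewrite -sum_nat_const -big_split /=; apply: leq_sum => u _.
  rewrite (card_nbhd (nbhd v)) addnC leq_add2r -(deg_miss _ u).
  exact: leq_addr.
lia.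
Qed.

End Graph.

Local Open Scope ring_scope.

(** * From the spectrum to a heavy vertex *)

(** The vertex [v] is one where an eigenvector has its largest absolute value;
    the right-hand side counts the walks of length two that start at [v]. *)
Lemma eigenvalue_sqr_le (R : realType) (G : sgraph) (a : R) :
  eigenvalue (adjacency_mx R G) a ->
  exists v : G, a ^+ 2 <= (\sum_(u in nbhd G v) #|nbhd G u|)%N%:R.
Proof.
move=> /eigenvalueP[x xA /rV0Pn[i0 xi0]].
pose y u := x ord0 (enum_rank u).
have eig u : a * y u = \sum_(w in nbhd G u) y w.
  have /rowP /(_ (enum_rank u)) := xA; rewrite !mxE => <-.
  rewrite (reindex (@enum_rank G)) /=; last exact/onW_bij/enum_rank_bij.
  rewrite [RHS]big_mkcond; apply: eq_bigr => w _.
  rewrite mxE !enum_rankK inE adj_sym.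
  by case: adj; rewrite ?mulr1 ?mulr0.
have [v _ ymax] := arg_maxP (fun u => `|y u|) (isT : xpredT (enum_val i0)).
have yv0 : 0 < `|y v|.
  apply: lt_le_trans (ymax (enum_val i0) isT).
  by rewrite /y enum_valK normr_gt0.
exists v; rewrite -(ler_pM2r yv0) -[a ^+ 2]ger0_norm ?sqr_ge0 //.
  rewrite -normrM expr2 -mulrA eig mulr_sumr.
  apply: le_trans (ler_norm_sum _ _ _) _.
  rewrite natr_sum mulr_suml; apply: ler_sum => u _.
  rewrite eig; apply: le_trans (ler_norm_sum _ _ _) _.
  by rewrite mulr_natl -sumr_const; apply: ler_sum => w _; exact: ymax.
Qed.

Theorem theorem4p1 (R : realType) :
  exists n0 : nat, forall n : nat, (n0 <= n)%N ->
  forall G : sgraph, #|G| = n ->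
    Num.sqrt ((n ^ 2 %/ 4)%N%:R : R) < spectral_radius R G ->
  forall t : nat, (3 <= t)%N -> t%:R <= n%:R / 160%:R :> R -> has_cycle G t.
Proof.
exists 0%N => n _ G Gn mu t t3 tn.
have tG : (160 * t <= #|G|)%N.
  by rewrite Gn -(ler_nat R) natrM mulrC -ler_pdivlMr ?ltr0n.
have [a eig_a lt_a] : exists2 a : R, eigenvalue (adjacency_mx R G) a &
    Num.sqrt (n ^ 2 %/ 4)%N%:R < a.
  have s0 := sqrtr_ge0 ((n ^ 2 %/ 4)%N%:R : R).
  move: mu; rewrite /spectral_radius; set E := (X in sup X) => mu.
  (* Without a supremum of the eigenvalues, [sup] is 0 and [mu] fails. *)
  have [supE|/sup_out E0] := boolp.pselect (has_sup E).
    by have [a Ea lta] := sup_gt supE.1 mu; exists a.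
  by move: mu; rewrite E0 ltNge s0.
have [v av] := eigenvalue_sqr_le _ _ _ eig_a.
apply: (heavy_vertex_cycle G v) => //; rewrite Gn -(ltr_nat R).
apply: lt_le_trans av; rewrite -[ltLHS]sqr_sqrtr ?ler0n //.
rewrite ltr_sqr ?nnegrE ?sqrtr_ge0 // ltW //.
exact: le_lt_trans (sqrtr_ge0 _) lt_a.
Qed.
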